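(* For $n\ge0$ let $A_n$ be the number of elements of $C_2\wr S_n$ that bi-avoid the pattern $(1\text{-}2,\,0~1)$ (with $A_0=1$). Then $$\sum_{n\ge0}A_n\frac{x^n}{n!}=\frac{e^{\frac{x}{1-x}}}{1-x}.$$
   Context: $C_2\wr S_n$ denotes the set of pairs $(\sigma,w)$ where $\sigma=\sigma_1\cdots\sigma_n$ is a permutation of $\{1,\dots,n\}$ in one-line notation and $w=w_1\cdots w_n\in\{0,1\}^n$. The element $(\sigma,w)$ bi-avoids the pattern $(1\text{-}2,\,0~1)$ if there are no indices $i<j$ with $\sigma_i<\sigma_j$ and $w_i<w_j$ (i.e. $w_i=0$, $w_j=1$). *)

(* Defs.v *)
(* MathComp, with function extensionality and classical structures from [boolp]. *)
From HB Require Import structures.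
From mathcomp Require Import all_boot all_order all_algebra all_fingroup.
From mathcomp Require Import zify boolp.

Set Implicit Arguments.
Unset Strict Implicit.
Unset Printing Implicit Defensive.

Import GRing.Theory.

Local Open Scope ring_scope.

(* A power series coerces to its coefficient function: [F n] is the coefficient
   of x^n. The record keeps the Cauchy product apart from the pointwise product
   that functions already carry. *)
Record fps (K : fieldType) := Fps { fps_coef :> nat -> K }.

HB.instance Definition _ (K : fieldType) := gen_eqMixin (fps K).
HB.instance Definition _ (K : fieldType) := gen_choiceMixin (fps K).

Lemma fpsP (K : fieldType) (F G : fps K) : (forall n, F n = G n) -> F = G.
Proof. by case: F G => f [g] /= /funext ->. Qed.

Section Ring.
Variable K : fieldType.
Implicit Types F G H : fps K.

Definition fps_zero : fps K := Fps (fun=> 0).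
Definition fps_opp F : fps K := Fps (fun n => - F n).
Definition fps_add F G : fps K := Fps (fun n => F n + G n).
Definition fps_one : fps K := Fps (fun n => (n == 0%N)%:R).
Definition fps_mul F G : fps K :=
  Fps (fun n => \sum_(i < n.+1) F i * G (n - i)%N).

Fact fps_addA : associative fps_add.
Proof. by move=> F G H; apply: fpsP => n; apply: addrA. Qed.
Fact fps_addC : commutative fps_add.
Proof. by move=> F G; apply: fpsP => n; apply: addrC. Qed.
Fact fps_add0 : left_id fps_zero fps_add.
Proof. by move=> F; apply: fpsP => n; apply: add0r. Qed.
Fact fps_addN : left_inverse fps_zero fps_opp fps_add.
Proof. by move=> F; apply: fpsP => n; apply: addNr. Qed.

HB.instance Definition _ :=
  GRing.isZmodule.Build (fps K) fps_addA fps_addC fps_add0 fps_addN.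

Let trunc N F : {poly K} := \poly_(i < N) F i.

Let mul_trunc N F G n :
  (n < N)%N -> fps_mul F G n = (trunc N F * trunc N G)`_n.
Proof.
move=> lt_nN; rewrite coefM; apply: eq_bigr => i _; rewrite !coef_poly.
have [-> ->] // : (i < N)%N /\ (n - i < N)%N by have := ltn_ord i; lia.
Qed.

Fact fps_mulC : commutative fps_mul.
Proof.
by move=> F G; apply: fpsP => n; rewrite !(@mul_trunc n.+1) // mulrC.
Qed.

Fact fps_mulA : associative fps_mul.
Proof.
have mul3 F G H n : fps_mul F (fps_mul G H) n =
    (trunc n.+1 F * (trunc n.+1 G * trunc n.+1 H))`_n.
  rewrite [RHS]coefM; apply: eq_bigr => i _.
  by rewrite coef_poly ltn_ord (@mul_trunc n.+1) // ltnS leq_subr.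
move=> F G H; rewrite [RHS]fps_mulC; apply: fpsP => n.
by rewrite !mul3 mulrA mulrC.
Qed.

Fact fps_mul1 : left_id fps_one fps_mul.
Proof.
move=> F; apply: fpsP => n /=; rewrite big_ord_recl /= mul1r subn0 big1 ?addr0 //.
by move=> i _; rewrite mul0r.
Qed.

Fact fps_mulDl : left_distributive fps_mul fps_add.
Proof.
move=> F G H; apply: fpsP => n /=; rewrite -big_split /=.
by apply: eq_bigr => i _; rewrite mulrDl.
Qed.

Fact fps_one_neq0 : fps_one != 0.
Proof. by apply/eqP => /(congr1 (@fps_coef K ^~ 0%N)) /eqP; rewrite oner_eq0. Qed.

HB.instance Definition _ := GRing.Zmodule_isComNzRing.Build (fps K)
  fps_mulA fps_mulC fps_mul1 fps_mulDl fps_one_neq0.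

Lemma fps_coef0 n : (0 : fps K) n = 0. Proof. by []. Qed.
Lemma fps_coefD F G n : (F + G) n = F n + G n. Proof. by []. Qed.
Lemma fps_coefN F n : (- F) n = - F n. Proof. by []. Qed.
Lemma fps_coef1 n : (1 : fps K) n = (n == 0%N)%:R. Proof. by []. Qed.
Lemma fps_coefM F G n : (F * G) n = \sum_(i < n.+1) F i * G (n - i)%N.
Proof. by []. Qed.
Lemma fps_coef_sum I r (P : pred I) (Fs : I -> fps K) n :
  (\sum_(i <- r | P i) Fs i) n = \sum_(i <- r | P i) Fs i n.
Proof. exact: (big_morph (fun F => fps_coef F n)). Qed.

Definition fpsX : fps K := Fps (fun n => (n == 1%N)%:R).

(* Composition G(F). When F has constant term 0, the powers F^k with k > n do
   not contribute to the coefficient of x^n (see [fps_expr_coef]), so the finite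
   sum below is that coefficient. Without this condition on F the value is
   meaningless. *)
Definition fps_comp G F : fps K :=
  Fps (fun n => \sum_(k < n.+1) G k * (F ^+ k) n).

Lemma fps_expr_coef F k n : F 0%N = 0 -> (n < k)%N -> (F ^+ k) n = 0.
Proof.
move=> F0; elim: k n => // k IHk n lt_nk.
rewrite exprS fps_coefM big_ord_recl F0 mul0r add0r big1 // => i _.
by rewrite IHk ?mulr0 //= /bump leq0n add1n; have := ltn_ord i; lia.
Qed.

(* F^-1 = c (1 + H + H^2 + ...) with c = 1 / F(0) and H = 1 - c F. *)
Definition fps_const (c : K) : fps K := Fps (fun n => c * (n == 0%N)%:R).
Definition fps_unit : {pred fps K} := [pred F : fps K | F 0%N != 0].
Definition fps_inv F : fps K :=
  if F 0%N == 0 then F else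
  fps_const (F 0%N)^-1 * fps_comp (Fps (fun=> 1)) (1 - fps_const (F 0%N)^-1 * F).

Fact fps_mulV : {in fps_unit, left_inverse 1 fps_inv *%R}.
Proof.
move=> F; rewrite inE /fps_inv => F0; rewrite (negPf F0).
set c := fps_const _; set H := 1 - c * F.
have H0 : H 0%N = 0.
  rewrite fps_coefD fps_coefN fps_coef1 fps_coefM big_ord1 /= mulr1.
  by rewrite mulVf // subrr.
rewrite mulrAC -[c * F](subKr 1) -/H; apply: fpsP => n.
pose S := \sum_(k < n.+1) H ^+ k.
have -> : ((1 - H) * fps_comp (Fps (fun=> 1)) H) n = ((1 - H) * S) n.
  rewrite !fps_coefM; apply: eq_bigr => i _; congr (_ * _).
  rewrite fps_coef_sum /= (big_ord_widen n.+1 (fun k => 1 * (H ^+ k) (n - i)%N)).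
    rewrite big_mkcond; apply: eq_bigr => k _; rewrite mul1r.
    by case: ifPn => //; rewrite -leqNgt => lt_nk; rewrite fps_expr_coef.
  by rewrite ltnS leq_subr.
have -> : (1 - H) * S = 1 - H ^+ n.+1.
  by rewrite -opprB mulNr -subrX1 opprB.
by rewrite fps_coefD fps_coefN fps_expr_coef // subr0.
Qed.

Fact fps_unitPl F G : G * F = 1 -> fps_unit F.
Proof.
move=> /(congr1 (@fps_coef K ^~ 0%N)) /eqP; rewrite fps_coefM big_ord1 /= => GF.
by apply: contraTneq GF => ->; rewrite mulr0 eq_sym oner_eq0.
Qed.

Fact fps_inv_out : {in [predC fps_unit], fps_inv =1 id}.
Proof. by move=> F; rewrite !inE negbK /fps_inv => ->. Qed.

HB.instance Definition _ := GRing.ComNzRing_hasMulInverse.Build (fps K)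
  fps_mulV fps_unitPl fps_inv_out.

(* e^F, for F with constant term 0 (as in [fps_comp]). *)
Definition fps_exp F : fps K := fps_comp (Fps (fun k => (k`!%:R)^-1)) F.

Definition egf (a : nat -> nat) : fps K := Fps (fun n => (a n)%:R / n`!%:R).

End Ring.

Arguments fpsX {K}.

(* C_2 wr S_n as a set of pairs (sigma, w), with positions and values numbered
   from 0. *)
Definition wreath2 (n : nat) : finType := ('S_n * {ffun 'I_n -> 'I_2})%type.

Definition bi_avoids n (e : wreath2 n) : bool :=
  [forall i : 'I_n, forall j : 'I_n,
    ~~ [&& (i < j)%N, (e.1 i < e.1 j)%N & (e.2 i < e.2 j)%N]].

Definition num_bi_avoiders (n : nat) : nat := #|[set e : wreath2 n | bi_avoids e]|.

Lemma num_bi_avoiders0 : num_bi_avoiders 0 = 1%N.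
Proof.
rewrite /num_bi_avoiders (_ : [set e | _] = setT).
  by rewrite cardsT card_prod card_Sn card_ffun !card_ord.
by apply/setP => e; rewrite !inE; apply/forallP => -[].
Qed.

(* Main.v *)
Require Import Defs.
From mathcomp Require Import all_boot all_order all_algebra.
From mathcomp Require Import all_fingroup.
From mathcomp Require Import zify ring.

Set Implicit Arguments.
Unset Strict Implicit.
Unset Printing Implicit Defensive.

Import GRing.Theory.
Local Open Scope ring_scope.

(** For a fixed permutation s, order the positions by i < j and s i < s j.
    Bi-avoidance says that the positions of colour 1 form an order ideal; order
    ideals correspond to antichains via their maximal elements, and antichains
    are the sets of positions on which s is decreasing. A given k-set of
    positions is decreasing for n!/k! permutations, whence
    A_n / n! = \sum_k C(n,k) / k!. On the other side, x^k / (1-x)^(k+1) is the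
    generating function of C(n,k) for fixed k. *)

(** * Order ideals and antichains of a finite strict order *)

Section IdealsAntichains.
Variables (T : finType) (lt : rel T).
Hypotheses (lt_irr : irreflexive lt) (lt_trans : transitive lt).

Definition ideal (A : {set T}) : bool :=
  [forall x, forall y, lt x y && (y \in A) ==> (x \in A)].
Definition antichain (A : {set T}) : bool :=
  [forall x in A, forall y in A, ~~ lt x y].

Definition maximals (A : {set T}) : {set T} :=
  [set x in A | [forall y in A, ~~ lt x y]].
Definition down_closure (A : {set T}) : {set T} :=
  [set x | [exists y in A, (x == y) || lt x y]].

Lemma idealP (A : {set T}) :
  reflect (forall x y, lt x y -> y \in A -> x \in A) (ideal A).
Proof.
apply: (iffP forallP) => [idA x y xy yA | idA x].
  by move: (idA x) => /forallP/(_ y); rewrite xy yA.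
by apply/forallP => y; apply/implyP => /andP[]; apply: idA.
Qed.

Lemma antichainP (A : {set T}) :
  reflect {in A &, forall x y, ~~ lt x y} (antichain A).
Proof.
apply: (iffP forall_inP) => [acA x y xA yA | acA x xA].
  by move/forall_inP: (acA x xA); apply.
by apply/forall_inP => y yA; apply: acA.
Qed.

Lemma maximal_above (A : {set T}) x :
  x \in A -> exists2 y, y \in maximals A & (x == y) || lt x y.
Proof.
move=> xA; pose P := [pred y | (y \in A) && ((x == y) || lt x y)].
have Px : P x by rewrite /= xA eqxx.
(* Among the elements of [A] equal to [x] or above it, [y] has the most elements below it. An
   element [z] of [A] above [y] would have strictly more: all those below [y], and [y] itself. *)
case: (arg_maxnP (fun y => #|[set z | lt z y]|) Px) => y /andP[yA xy] max_y.
exists y => //; rewrite inE yA /=; apply/forall_inP => z zA.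
apply/negP => yz; have: P z.
  by rewrite /= zA; case/orP: xy => [/eqP-> | xy]; rewrite ?yz ?(lt_trans xy yz) orbT.
move/max_y; apply/negP; rewrite -ltnNge; apply: proper_card; apply/properP; split.
  by apply/subsetP => t; rewrite !inE => /lt_trans; apply.
by exists y; rewrite inE // lt_irr.
Qed.

Lemma antichain_maximals A : antichain (maximals A).
Proof.
apply/antichainP => x y; rewrite !inE => /andP[_ /forall_inP max_x] /andP[yA _].
exact: max_x.
Qed.

Lemma ideal_down_closure A : ideal (down_closure A).
Proof.
apply/idealP => x y xy; rewrite !inE => /exists_inP[z zA yz]; apply/exists_inP.
exists z => //; case/orP: yz => [/eqP<- | yz]; first by rewrite xy orbT.
by rewrite (lt_trans xy yz) orbT.
Qed.

Lemma maximalsK A : ideal A -> down_closure (maximals A) = A.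
Proof.
move=> /idealP idA; apply/setP => x; rewrite inE; apply/exists_inP/idP.
  by case=> y; rewrite inE => /andP[yA _] /orP[/eqP-> // | /idA]; apply.
exact: maximal_above.
Qed.

Lemma down_closureK A : antichain A -> maximals (down_closure A) = A.
Proof.
move=> /antichainP acA.
have sub x : x \in A -> x \in down_closure A.
  by move=> xA; rewrite inE; apply/exists_inP; exists x; rewrite ?eqxx.
apply/setP => x; rewrite inE; apply/andP/idP => [[xd /forall_inP max_x] | xA].
  move: xd; rewrite inE => /exists_inP[y yA /orP[/eqP-> // | xy]].
  by move: (max_x y (sub y yA)); rewrite xy.
split; first exact: sub.
apply/forall_inP => y; rewrite inE => /exists_inP[z zA yz]; apply/negP => xy.
have: lt x z by case/orP: yz => [/eqP<- | /(lt_trans xy)].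
by apply/negP; apply: acA.
Qed.

(** [maximals] maps ideals to antichains bijectively, with inverse [down_closure]. *)
Lemma card_ideal_antichain :
  #|[set A | ideal A]| = #|[set A | antichain A]|.
Proof.
rewrite -(card_in_imset (f := maximals) (D := mem [set A | ideal A])); last first.
  move=> A B; rewrite !inE => idA idB eqAB.
  by rewrite -(maximalsK idA) -(maximalsK idB) eqAB.
apply: eq_card => A; rewrite [RHS]inE; apply/imsetP/idP => [[B _ ->] | acA].
  exact: antichain_maximals.
by exists (down_closure A); rewrite ?inE ?ideal_down_closure ?down_closureK.
Qed.

End IdealsAntichains.

(** * Bi-avoiding colourings of a fixed permutation *)

Definition pattern_lt n (s : 'S_n) (i j : 'I_n) : bool :=
  (i < j)%N && (s i < s j)%N.

Lemma pattern_lt_irr n (s : 'S_n) : irreflexive (pattern_lt s).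
Proof. by move=> i; rewrite /pattern_lt ltnn. Qed.

Lemma pattern_lt_trans n (s : 'S_n) : transitive (pattern_lt s).
Proof. by move=> j i k /andP[? ?] /andP[? ?]; apply/andP; split; lia. Qed.

Lemma card_bi_avoids n (s : 'S_n) :
  #|[set w : {ffun 'I_n -> 'I_2} | bi_avoids (s, w)]|
  = #|[set A | antichain (pattern_lt s) A]|.
Proof.
rewrite -card_ideal_antichain; [|exact: pattern_lt_irr|exact: pattern_lt_trans].
(* A word is identified with its set of positions of colour 1, which is [ord_max] in ['I_2]. An
   occurrence of the pattern is then exactly a failure of this set to be closed downwards. *)
pose f (w : {ffun 'I_n -> 'I_2}) := [set i | w i == ord_max].
pose g (A : {set 'I_n}) : {ffun 'I_n -> 'I_2} :=
  [ffun i => if i \in A then ord_max else ord0].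
have fK : cancel f g.
  move=> w; apply/ffunP => i; rewrite ffunE inE.
  by case: eqP => [-> // | ne]; apply: val_inj; move: ne; case: (w i) => [[|[|]]] //=
    ? []; apply: val_inj.
have gK : cancel g f.
  by move=> A; apply/setP => i; rewrite inE ffunE; case: (i \in A).
rewrite -(card_imset _ (can_inj fK)); apply: eq_card => A.
rewrite (can2_imset_pre _ fK gK) !inE; apply/forallP/idealP => /= av.
  move=> i j /andP[ij sij] jA; move: (av i) => /forallP/(_ j).
  by rewrite ij sij !ffunE jA; case: (i \in A).
move=> i; apply/forallP => j; apply/negP => /and3P[ij sij]; rewrite !ffunE.
by have := av i j; rewrite /pattern_lt ij sij; case: (j \in A) => [->|] //; case: (i \in A).
Qed.

(** * Permutations decreasing on a given set of positions *)

Section Decreasing.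
Variables (n : nat) (A : {set 'I_n}).

Notation decreasing_on s := (antichain (pattern_lt s) A).

Lemma decreasing_onP (s : 'S_n) :
  reflect {in A &, forall i j : 'I_n, (i < j)%N -> (s j < s i)%N}
          (decreasing_on s).
Proof.
apply: (iffP (antichainP _ _)) => dec i j iA jA.
  move=> ij; move: (dec i j iA jA); rewrite /pattern_lt ij /= -leqNgt leq_eqVlt.
  by case/orP => // /eqP/val_inj/perm_inj eji; rewrite eji ltnn in ij.
by apply/negP => /andP[ij]; apply/negP; rewrite -leqNgt ltnW // dec.
Qed.

Lemma exists_decreasing (s : 'S_n) :
  exists2 p : 'S_n, perm_on A p & decreasing_on (p * s)%g.
Proof.
(* By rearrangement, swapping an ascent within A strictly lowers this weight. *)
pose weight (p : 'S_n) := (\sum_(i < n) i * (p * s)%g i)%N.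
case: (arg_minnP (P := [pred p | perm_on A p]) weight (perm_on1 A)) => p pA min_p.
exists p => //; apply/antichainP => i j iA jA; apply/negP => /= /andP[ij sij].
have ne_ji : j != i by rewrite -val_eqE /= gtn_eqF.
have /min_p : perm_on A (tperm i j * p)%g.
  apply: perm_onM pA; apply/subsetP => k; rewrite inE.
  by apply: contraR => kA; rewrite tpermD //; apply: contraNneq kA => <-.
apply/negP; rewrite -ltnNge /weight.
have split_sum (F : 'I_n -> nat) :
    (\sum_(k < n) F k = F i + (F j + \sum_(k < n | (k != i) && (k != j)) F k))%N.
  by rewrite (bigD1 i) //= (bigD1 j).
rewrite !split_sum -mulgA !permM tpermL tpermR.
have -> : (\sum_(k < n | (k != i) && (k != j)) k * (tperm i j * (p * s))%g k
    = \sum_(k < n | (k != i) && (k != j)) k * (p * s)%g k)%N.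
  by apply: eq_bigr => k /andP[ki kj]; rewrite (permM (tperm i j)) tpermD // eq_sym.
move: sij; rewrite !permM => sij; rewrite !addnA ltn_add2r; nia.
Qed.

(** Read along the positions of [A] in increasing order, [s] and [p * s] take the same values, since
    [p] preserves [A], and both lists are decreasing. Hence the lists agree term by term, and
    injectivity of [s] forces [p] to fix [A] pointwise. *)
Lemma decreasing_unique (s p : 'S_n) :
  perm_on A p -> decreasing_on s -> decreasing_on (p * s)%g -> p = 1%g.
Proof.
move=> pA /decreasing_onP dec_s /decreasing_onP dec_ps.
have sorted_dec (t : 'S_n) : {in A &, forall i j : 'I_n, (i < j)%N -> (t j < t i)%N} ->
    sorted (fun i j : 'I_n => (j < i)%N) [seq t i | i <- enum A].
  move=> dec; rewrite sorted_map.
  (* [enum A] is increasing, as a subsequence of the enumeration of ['I_n]. *)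
  have: sorted (relpre val ltn) (enum A).
    rewrite -sorted_map; apply: (subseq_sorted ltn_trans _ (iota_ltn_sorted 0 n)).
    rewrite -val_enum_ord; apply: map_subseq.
    by rewrite enumT; apply: filter_subseq.
  apply: (sub_in_sorted (P := mem A)); first by move=> i j iA jA; apply: dec.
  by apply/allP => i; rewrite mem_enum.
have eq_ps : [seq (p * s)%g i | i <- enum A] = [seq s i | i <- enum A].
  apply: (sorted_eq (leT := fun i j : 'I_n => (j < i)%N)).
  - by move=> j i k ij jk; lia.
  - by move=> i j /andP[]; lia.
  - exact: sorted_dec.
  - exact: sorted_dec.
  - apply: uniq_perm; rewrite ?map_inj_uniq ?enum_uniq //; try exact: perm_inj.
    move=> k; apply/mapP/mapP => -[i]; rewrite mem_enum => iA ->.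
      by exists (p i); rewrite ?permM // mem_enum perm_closed.
    exists (p^-1%g i); last by rewrite permM permKV.
    by rewrite mem_enum -(perm_closed _ pA) permKV.
apply/permP => i; rewrite perm1; have [iA | iA] := boolP (i \in A); last exact: out_perm pA iA.
have /eq_in_map/(_ i) := eq_ps; rewrite mem_enum iA permM => /(_ isT).
exact: perm_inj.
Qed.

(** Since [p * s] applies [p] first, multiplying by [p] supported on [A] permutes the values of [s]
    on [A]. Every permutation factors uniquely as such a [p] times one decreasing on [A], and there
    are #|A|! choices of [p]. *)
Lemma card_decreasing : (#|A|`! * #|[set s | decreasing_on s]|)%N = n`!.
Proof.
rewrite -card_perm -card_Sn -[#|perm_on A|]cardsE -cardsX.
rewrite -(card_in_imset (f := fun ps => (ps.1 * ps.2)%g)); last first.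
  move=> [p s] [q t] /setXP[/=]; rewrite !inE => pA dec_s.
  move=> /andP[/= qA dec_t] eq_ps.
  (* Both [s] and [t] are decreasing on [A] and differ by a permutation supported on [A], so
     uniqueness makes that permutation trivial. *)
  have qpt : t = (q^-1 * p * s)%g by rewrite -mulgA eq_ps mulKg.
  have: (q^-1 * p)%g = 1%g.
    apply: decreasing_unique dec_s _; last by rewrite -qpt.
    by apply: perm_onM; rewrite ?perm_onV.
  move=> qp1; move: qpt; rewrite qp1 mul1g => ->.
  by move/(canRL (mulKg _)): qp1; rewrite invgK mulg1 => ->.
apply: eq_card => s; rewrite [RHS]inE; apply/imsetP.
have [p pA dec] := exists_decreasing s.
exists (p^-1, p * s)%g; last by rewrite /= mulKg.
by apply/setXP; split; rewrite inE /= ?dec //; apply: perm_onV.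
Qed.

End Decreasing.

(** * The closed formula for A_n / n! *)

(** Pairs of a permutation and an antichain are counted by the antichain first: each set [A]
    contributes 1 / #|A|! after division by n!, and C(n,k) sets have size k. *)
Lemma num_bi_avoiders_fact n :
  (num_bi_avoiders n)%:R / n`!%:R = \sum_(k < n.+1) 'C(n, k)%:R / k`!%:R :> rat.
Proof.
have -> : num_bi_avoiders n =
    (\sum_(A : {set 'I_n}) #|[set s : 'S_n | antichain (pattern_lt s) A]|)%N.
  transitivity (\sum_(s : 'S_n) #|[set A | antichain (pattern_lt s) A]|)%N.
    rewrite /num_bi_avoiders -sum1dep_card.
    rewrite -(pair_big_dep xpredT (fun s w => bi_avoids (s, w)) (fun _ _ => 1%N)) /=.
    by apply: eq_bigr => s _; rewrite sum1dep_card card_bi_avoids.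
  under eq_bigr do rewrite -sum1dep_card.
  rewrite (exchange_big_dep xpredT) //=.
  by apply: eq_bigr => A _; rewrite sum1dep_card.
rewrite natr_sum mulr_suml.
rewrite (eq_bigr (fun A : {set 'I_n} => (#|A|`!%:R)^-1 : rat)); last first.
  have fact_neq0 m : m`!%:R != 0 :> rat by rewrite Num.Theory.pnatr_eq0 -lt0n fact_gt0.
  move=> A _; have := card_decreasing A; set d := #|[set _ | _]| => <-.
  (* The product equals n!, so [d] is nonzero and can be cancelled. *)
  have: (#|A|`! * d)%N != 0%N by rewrite card_decreasing -lt0n fact_gt0.
  rewrite muln_eq0 negb_or => /andP[_ d0].
  by rewrite natrM; field; rewrite fact_neq0 Num.Theory.pnatr_eq0.
have card_lt (A : {set 'I_n}) : (#|A| < n.+1)%N.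
  by rewrite ltnS -[n in (_ <= n)%N]card_ord max_card.
rewrite (partition_big (fun A => Ordinal (card_lt A)) xpredT) //=.
apply: eq_bigr => k _.
rewrite (eq_bigr (fun=> (k`!%:R)^-1)); last by move=> A /eqP <-.
rewrite sumr_const -[LHS]mulr_natl; congr (_%:R * _).
have := card_draws 'I_n k; rewrite card_ord cardsE => <-.
by apply: eq_card.
Qed.

(** * Generating functions of the columns of Pascal's triangle *)

Section PowerSeries.
Variable K : fieldType.
Implicit Types F G H : fps K.

Lemma fps_coef_mulX F n : (fpsX * F) n = if n is m.+1 then F m else 0.
Proof.
rewrite fps_coefM big_ord_recl /= mul0r add0r.
case: n => [|n]; first by rewrite big_ord0.
rewrite big_ord_recl /= mul1r subSS subn0 big1 ?addr0 // => i _.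
by rewrite mul0r.
Qed.

Definition fps_bin k : fps K := Fps (fun n => 'C(n, k)%:R).

Lemma fps_bin0 : (1 - fpsX) * fps_bin 0 = 1.
Proof.
apply: fpsP => n; rewrite mulrBl mul1r fps_coefD fps_coefN fps_coef_mulX fps_coef1 /=.
by case: n => [|n]; rewrite !bin0 ?subr0 ?subrr.
Qed.

(** Pascal's rule, read off coefficient by coefficient. *)
Lemma fps_binS k : (1 - fpsX) * fps_bin k.+1 = fpsX * fps_bin k.
Proof.
apply: fpsP => n; rewrite mulrBl mul1r fps_coefD fps_coefN !fps_coef_mulX /=.
by case: n => [|n]; rewrite ?bin0n ?subr0 // binS natrD addrC addKr.
Qed.

Lemma unit_1subX : (1 - fpsX : fps K) \is a GRing.unit.
Proof. by apply/unitrPr; exists (fps_bin 0); apply: fps_bin0. Qed.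

Lemma fps_binE k : (fpsX / (1 - fpsX)) ^+ k / (1 - fpsX) = fps_bin k.
Proof.
elim: k => [|k IHk]; apply: (mulrI unit_1subX).
  by rewrite fps_bin0 expr0 mul1r divrr // unit_1subX.
rewrite fps_binS -IHk exprS -[X in _ * X]mulrA [LHS]mulrA; congr (_ * _).
by rewrite mulrC divrK ?unit_1subX.
Qed.

(** This lets a factor pass inside the composition. The inner sum stops at k = i for the coefficient
    of x^i, but it extends to k = n because F^k has no terms of degree below k. *)
Lemma fps_comp_mul_coef G F H n : F 0%N = 0 ->
  (fps_comp G F * H) n = \sum_(k < n.+1) G k * (F ^+ k * H) n.
Proof.
move=> F0; rewrite fps_coefM.
under [RHS]eq_bigr do rewrite fps_coefM mulr_sumr.
rewrite exchange_big /=; apply: eq_bigr => i _.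
rewrite mulr_suml (big_ord_widen n.+1 (fun k => G k * (F ^+ k) i * H (n - i)%N)) //.
rewrite big_mkcond; apply: eq_bigr => k _; rewrite mulrA.
by case: ifPn => //; rewrite -leqNgt => lt_ik; rewrite fps_expr_coef // mulr0 mul0r.
Qed.

End PowerSeries.

(** * Comparison of coefficients *)

Theorem theorem3 :
  egf rat num_bi_avoiders = fps_exp (fpsX / (1 - fpsX)) / (1 - fpsX) :> fps rat.
Proof.
apply: fpsP => n; rewrite [LHS]num_bi_avoiders_fact fps_comp_mul_coef.
  by apply: eq_bigr => k _; rewrite fps_binE /= mulrC.
(* The composed series x / (1-x) has constant term 0, as the composition requires. *)
by rewrite fps_coef_mulX.
Qed.
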